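(* Let $n\ge 3$, let $\mathcal{M}$ be a collection of $m\ge 1$ lines in general linear position in $\mathbb{P}^n$, and let $R$ be the coordinate ring of $\mathcal{M}$. If $n+1\ge 2m$, then after a linear change of coordinates (change of basis of $S_1$, where $S=\mathbb{C}[x_0,\ldots,x_n]$) the defining ideal of $\mathcal{M}$ is minimally generated by monomials of degree at most $2$. Thus $R$ is Koszul.
   Context: Let $\mathbb{P}^n$ be projective $n$-space over $\mathbb{C}$ with homogeneous coordinate ring $S=\mathbb{C}[x_0,\ldots,x_n]$ (standard grading). The defining ideal of a line in $\mathbb{P}^n$ is the ideal of $S$ of all forms vanishing on it. For a collection $\mathcal{M}=\{\mathcal{L}_1,\ldots,\mathcal{L}_m\}$ of lines with defining ideals $L_1,\ldots,L_m$, the defining ideal of $\mathcal{M}$ is $J=\bigcap_{i=1}^m L_i$ and the coordinate ring of $\mathcal{M}$ is $R=S/J$. The lines of $\mathcal{M}$ are in general linear position if any $s$ of the lines span a $\mathbb{P}^r$ with $r=\min\{2s-1,n\}$. A standard graded $\mathbb{C}$-algebra $R$ is Koszul if $\mathbb{C}=R/\mathfrak{m}_R$ (with $\mathfrak{m}_R$ the maximal homogeneous ideal) has a linear free resolution over $R$, i.e. $\mathrm{Tor}_i^R(\mathbb{C},\mathbb{C})_j=0$ for all $i\neq j$. *)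

(* Defs.v *)
From HB Require Import structures.
From mathcomp Require Import all_boot all_order all_algebra.
From mathcomp Require Import boolp classical_sets reals complex mpoly.
From mathcomp Require Import generic_quotient ring_quotient.

Set Implicit Arguments.
Unset Strict Implicit.
Unset Printing Implicit Defensive.
Import GRing.Theory.
Local Open Scope ring_scope.
Local Open Scope classical_set_scope.

Section Ideals.
Variable A : comNzRingType.
Implicit Types (G I : set A).

Definition ideal_gen G : set A :=
  [set p | exists k (c f : 'I_k -> A),
     (forall i, G (f i)) /\ p = \sum_(i < k) c i * f i].

(* For a homogeneous ideal, irredundancy of a set of homogeneous generators is
   the usual notion of a minimal set of generators. *)
Definition minimally_generates G I : Prop :=
  ideal_gen G = I /\
  forall G' : set A, G' `<=` G -> ideal_gen G' = I -> G' = G.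

Lemma ideal_gen_closed G :
  [/\ ideal_gen G 0,
      forall x y, ideal_gen G x -> ideal_gen G y -> ideal_gen G (x + y)
    & forall a x, ideal_gen G x -> ideal_gen G (a * x)].
Proof.
split.
- exists 0%N, (fun=> 0), (fun=> 0); split; first by case.
  by rewrite big_ord0.
- move=> x y [k [c [f [Gf ->]]]] [l [c' [f' [Gf' ->]]]].
  exists (k + l)%N.
  exists (fun i => match fintype.split i with inl j => c j | inr j => c' j end).
  exists (fun i => match fintype.split i with inl j => f j | inr j => f' j end).
  split=> [i|]; first by case: (fintype.split i) => j; [exact: Gf|exact: Gf'].
  rewrite big_split_ord /=; congr (_ + _); apply: eq_bigr => i _.
    by rewrite (unsplitK (inl i)).
  by rewrite (unsplitK (inr i)).
- move=> a x [k [c [f [Gf ->]]]]; exists k, (fun i => a * c i), f; split=> //.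
  by rewrite mulr_sumr; apply: eq_bigr => i _; rewrite mulrA.
Qed.

End Ideals.

Section Koszul.
Variables (A : comNzRingType) (gr : nat -> set A).

(* [gr d] is the homogeneous part of degree [d] of the graded ring [A]; this is
   its maximal homogeneous ideal when [gr 0] is a field. *)
Definition irrelevant_ideal : set A :=
  ideal_gen [set a | exists2 d, (0 < d)%N & gr d a].

(* A linear free resolution of [k = A / irrelevant_ideal] over [A]:
     ... -> A(-2)^(b 2) -> A(-1)^(b 1) -> A -> k -> 0.
   The modules are spaces of row vectors, on which [d i] acts on the right; the
   degree 0 homomorphisms A(-i-1)^(b i.+1) -> A(-i)^(b i) are exactly those
   given by matrices with entries in [gr 1].  The map A -> k is the canonical
   one, whence the condition on the image of [d 0]. *)
Definition linear_resolution (b : nat -> nat)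
    (d : forall i, 'M[A]_(b i.+1, b i)) : Prop :=
  [/\ b 0%N = 1%N,
      forall i j k, gr 1%N (d i j k),
      forall u : 'rV[A]_(b 0%N),
        (exists w, u = w *m d 0%N) <-> (forall k, irrelevant_ideal (u 0 k))
    & forall i (u : 'rV[A]_(b i.+1)),
        (exists w, u = w *m d i.+1) <-> u *m d i = 0].

Definition koszul : Prop := exists b d, @linear_resolution b d.

End Koszul.

Section Lines.
Variables (R : realType) (n : nat).
Local Notation C := (R[i]).
Local Notation S := {mpoly C[n.+1]}.

(* A line of P^n, as a plane in the space C^(n+1) of homogeneous coordinates. *)
Record line := Line {
  line_space :> {vspace 'rV[C]_n.+1};
  line_dim : \dim line_space = 2%N
}.

Definition vanishes_on (l : line) (f : S) : Prop :=
  forall v : 'rV[C]_n.+1, v \in line_space l -> v != 0 ->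
    f.@[fun i => v 0 i] = 0.

Definition line_ideal (l : line) : set S :=
  ideal_gen [set f | (exists d, f \is d.-homog) /\ vanishes_on l f].

(* The projective dimension of a linear span is one less than the dimension of
   the corresponding vector space. *)
Definition general_linear_position m (L : 'I_m -> line) : Prop :=
  forall A : {set 'I_m}, (0 < #|A|)%N ->
    (\dim (\sum_(i in A) line_space (L i))%VS).-1
      = minn (2 * #|A| - 1) n.

Definition defining_ideal m (L : 'I_m -> line) : set S :=
  \bigcap_i line_ideal (L i).

(* The endomorphism of [S] with 'X_i |-> \sum_j M i j *: 'X_j; it is a linear
   change of coordinates when [M] is invertible. *)
Definition linear_subst (M : 'M[C]_n.+1) (p : S) : S :=
  p \mPo [tuple \sum_j M i j *: 'X_j | i < n.+1].

Lemma line_ideal_vanishes l f : line_ideal l f -> vanishes_on l f.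
Proof.
case=> k [c [g [Hg ->]]] v vl v0.
rewrite rmorph_sum /= big1 // => i _.
by rewrite mevalM (Hg i).2 // mulr0.
Qed.

Definition defining_ideal_pred m (L : 'I_m -> line) : S -> bool :=
  fun p => `[< defining_ideal L p >].

Lemma defining_ideal_closed m (m_gt0 : (0 < m)%N) (L : 'I_m -> line) :
  idealr_closed (defining_ideal_pred L).
Proof.
split.
- by apply/asboolP => i _; have [] := ideal_gen_closed
    [set f | (exists d, f \is d.-homog) /\ vanishes_on (L i) f].
- apply/negP => /asboolP /(_ (Ordinal m_gt0) I) /line_ideal_vanishes H.
  have vl := memv_pick (line_space (L (Ordinal m_gt0))).
  have := H _ vl; rewrite vpick0 -dimv_eq0 line_dim meval1 => /(_ isT) /eqP.
  by rewrite oner_eq0.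
- move=> a x y /asboolP Jx /asboolP Jy; apply/asboolP => i _.
  have [_ JD JM] := ideal_gen_closed
    [set f | (exists d, f \is d.-homog) /\ vanishes_on (L i) f].
  by apply: (JD); [apply: (JM); exact: Jx|exact: Jy].
Qed.

(* The ring quotients of the library are by proper ideals, whence [m_gt0]. *)
Definition defining_idealr m (m_gt0 : (0 < m)%N) (L : 'I_m -> line) : idealr S :=
  HB.pack (defining_ideal_pred L)
    (isIdealr.Build S (defining_ideal_pred L) (defining_ideal_closed m_gt0 L)).

Definition coordinate_ring m (m_gt0 : (0 < m)%N) (L : 'I_m -> line)
  : comNzRingType := {ideal_quot (defining_idealr m_gt0 L)}.

Arguments coordinate_ring [m] m_gt0 L.

Definition coordinate_ring_gr m (m_gt0 : (0 < m)%N) (L : 'I_m -> line) (d : nat)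
  : set (coordinate_ring m_gt0 L) :=
  [set \pi_{ideal_quot (defining_idealr m_gt0 L)}%qT p |
    p in [set p : S | p \is d.-homog]].

End Lines.

Arguments coordinate_ring_gr [R n m] m_gt0 L d _.

(* Main.v *)
Require Import Defs.
From HB Require Import structures.
From mathcomp Require Import all_boot all_order all_algebra.
From mathcomp Require Import boolp classical_sets reals complex mpoly.
From mathcomp Require Import generic_quotient ring_quotient.

(* In coordinates adapted to the lines, the i-th line is spanned by two basis
   vectors, so a polynomial lies in its ideal iff it vanishes after setting all
   the other variables to zero.  The defining ideal is therefore spanned by the
   monomials that are not supported on a single line, and is generated by those
   of them that are minimal for divisibility.

   The coordinate ring is a fiber product over C of polynomial rings A_i in two
   variables x_i, y_i.  Its maximal ideal is the direct sum of the ideals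
   m_i = (x_i, y_i); the first syzygies of A_i are the sum of the m_j, j <> i,
   and those of m_i are two copies of them plus the Koszul syzygy
   (y_i, - x_i), which generates a copy of A_i.  So the class of direct sums of
   modules A_i and m_i is stable under linear syzygies. *)

Set Implicit Arguments.
Unset Strict Implicit.
Unset Printing Implicit Defensive.
Import GRing.Theory Num.Theory.
Local Open Scope ring_scope.
Local Open Scope classical_set_scope.

(** * Setting variables to zero *)

Section Restriction.
Variables (K : fieldType) (N : nat).
Implicit Types (B : pred 'I_N) (p q : {mpoly K[N]}) (u : 'X_{1..N}).

Definition supported B u := [forall k, B k || (u k == 0%N)].

(** Being a substitution, this is a ring morphism at once; [mcoeff_restr] recovers the
    coefficientwise description. *)
Definition restr B p := p \mPo [tuple if B k then 'X_k else 0 | k < N].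

Lemma supported_add B u v :
  supported B (u + v)%MM = supported B u && supported B v.
Proof.
apply/forallP/andP => [H|[/forallP Hu /forallP Hv] k].
  by split; apply/forallP => k; move: (H k); rewrite mnmDE addn_eq0;
    case: (B k) => //= /andP[].
by rewrite mnmDE addn_eq0; case: (B k) (Hu k) (Hv k) => //= -> ->.
Qed.

Lemma supported_mnm1 B k : supported B U_(k) = B k.
Proof.
apply/forallP/idP => [/(_ k)|Bk j]; first by rewrite mnm1E eqxx orbF.
by rewrite mnm1E eqb0; case: eqVneq => [<-|]; rewrite ?Bk ?orbT.
Qed.

Lemma not_supported B u :
  ~~ supported B u -> exists2 k, ~~ B k & (U_(k) <= u)%MM.
Proof.
rewrite negb_forall => /existsP[k]; rewrite negb_or => /andP[nBk uk].
by exists k; rewrite ?lep1mP.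
Qed.

Lemma restrX B u : restr B 'X_[u] = if supported B u then 'X_[u] else 0.
Proof.
rewrite /restr comp_mpolyX; case: ifP => [/forallP Bu|].
  rewrite [RHS]mpolyXE_id; apply: eq_bigr => k _; rewrite tnth_mktuple.
  by case: (B k) (Bu k) => //= /eqP ->; rewrite !expr0.
move=> /negbT; rewrite negb_forall => /existsP[k].
rewrite negb_or => /andP[/negPf nBk uk].
by rewrite (bigD1 k) //= tnth_mktuple nBk expr0n (negPf uk) mul0r.
Qed.

Lemma mcoeff_restr B p u : (restr B p)@_u = if supported B u then p@_u else 0.
Proof.
have -> : restr B p = \sum_(v <- msupp p) p@_v *: restr B 'X_[v].
  rewrite {1}(mpolyE p) /restr raddf_sum /=.
  by apply: eq_bigr => v _; rewrite comp_mpolyZ.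
rewrite raddf_sum /=; case: ifP => Bu; last first.
  apply: big1 => v _; rewrite mcoeffZ restrX.
  case: ifP => Bv; rewrite ?mcoeff0 ?mulr0 // mcoeffX.
  by case: eqVneq Bv => [->|]; rewrite ?Bu ?mulr0.
rewrite [in RHS](mpolyE p) raddf_sum /=.
apply: eq_bigr => v _; rewrite !mcoeffZ restrX.
case: ifP => Bv //; rewrite mcoeff0 mcoeffX.
by case: eqVneq Bv => [->|]; rewrite ?Bu.
Qed.

Lemma restr_eq0P B p :
  restr B p = 0 <-> (forall u, supported B u -> p@_u = 0).
Proof.
split=> [H u Bu|H]; first by have := mcoeff_restr B p u; rewrite H Bu mcoeff0.
by apply/mpolyP => u; rewrite mcoeff_restr mcoeff0; case: ifP => // /H.
Qed.

Lemma restr_id B p : restr B (restr B p) = restr B p.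
Proof. by apply/mpolyP => u; rewrite !mcoeff_restr; case: (supported B u). Qed.

Lemma mpolyU_neq0 k : 'X_k != 0 :> {mpoly K[N]}.
Proof.
apply/eqP => /mpolyP /(_ U_(k)%MM) /eqP.
by rewrite mcoeffXU eqxx mcoeff0 oner_eq0.
Qed.

Lemma restrU B k : restr B 'X_k = if B k then 'X_k else 0.
Proof. by rewrite restrX supported_mnm1. Qed.

Lemma restrD B p q : restr B (p + q) = restr B p + restr B q.
Proof. exact: comp_mpolyD. Qed.

Lemma restrN B p : restr B (- p) = - restr B p.
Proof. exact: comp_mpolyN. Qed.

Lemma restrM B p q : restr B (p * q) = restr B p * restr B q.
Proof. exact: rmorphM. Qed.

(** Every monomial of [p] involves a variable outside [B], which can be factored out. Thus the
    kernel of the restriction is generated by the variables set to zero. *)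
Lemma restr_eq0_ideal B p : restr B p = 0 ->
  exists c : 'I_N -> {mpoly K[N]}, p = \sum_(k | ~~ B k) c k * 'X_k.
Proof.
move=> /restr_eq0P Bp; rewrite (mpolyE p) big_seq.
apply: (big_ind (fun q => exists c, q = \sum_(k | ~~ B k) c k * 'X_k)).
- by exists (fun=> 0); rewrite big1 // => k _; rewrite mul0r.
- move=> _ _ [c ->] [c' ->]; exists (fun k => c k + c' k).
  by rewrite -big_split; apply: eq_bigr => k _; rewrite mulrDl.
move=> u; rewrite mcoeff_msupp => pu.
have /not_supported [k nBk ku] : ~~ supported B u.
  by apply/negP => /Bp; apply/eqP.
exists (fun j => if j == k then p@_u *: 'X_[u - U_(k)] else 0).
rewrite (bigD1 k) //= eqxx big1 => [|j /andP[_ /negPf ->]].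
  by rewrite addr0 -scalerAl -mpolyXD submK.
by rewrite mul0r.
Qed.

(** The Koszul relation between two distinct variables. Setting ['X_l] to zero in the relation shows
    that ['X_l] divides [p]; the value of [q] then follows by cancelling ['X_l]. *)
Lemma syzygyX (k l : 'I_N) p q : k != l -> p * 'X_k + q * 'X_l = 0 ->
  exists c, p = c * 'X_l /\ q = - c * 'X_k.
Proof.
move=> kl pq0; have : restr (predC1 l) p * 'X_k = 0.
  have := congr1 (restr (predC1 l)) pq0.
  by rewrite restrD !restrM !restrU /= eqxx kl mulr0 addr0 /restr raddf0.
move/eqP; rewrite mulf_eq0 (negPf (mpolyU_neq0 k)) orbF => /eqP.
move=> /restr_eq0_ideal [c pE].
have pcl : p = c l * 'X_l.
  by rewrite pE (eq_bigl (pred1 l)) ?big_pred1_eq // => j /=; rewrite negbK.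
exists (c l); split=> //; apply: (mulIf (mpolyU_neq0 l)).
move: pq0; rewrite pcl addrC => /eqP; rewrite addr_eq0 => /eqP ->.
by rewrite !mulNr mulrAC.
Qed.

End Restriction.

(** * Monomial ideals *)

Section IdealGen.
Variables (A : comNzRingType) (G : set A).

Lemma ideal_gen_mem f : G f -> ideal_gen G f.
Proof.
move=> Gf; exists 1%N, (fun=> 1), (fun=> f).
by rewrite big_ord1 mul1r.
Qed.

Lemma ideal_gen_sum (I : Type) (r : seq I) (P : pred I) (F : I -> A) :
  (forall i, P i -> ideal_gen G (F i)) -> ideal_gen G (\sum_(i <- r | P i) F i).
Proof. by have [G0 GD _] := ideal_gen_closed G; apply: big_ind. Qed.

End IdealGen.

Section MonomialIdeal.
Variables (K : fieldType) (N : nat) (Q : 'X_{1..N} -> Prop).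
Hypothesis Qup : forall u w, (u <= w)%MM -> Q u -> Q w.

Definition minimal_monomials : set {mpoly K[N]} :=
  [set f | exists u,
    [/\ f = 'X_[u], Q u & forall w, (w <= u)%MM -> Q w -> w = u]].

(** Induction on the degree: a proper divisor of a monomial has strictly smaller degree. *)
Lemma minimal_le u : Q u ->
  exists w, [/\ (w <= u)%MM, Q w & forall v, (v <= w)%MM -> Q v -> v = w].
Proof.
have [d] := ubnP (mdeg u); elim: d u => // d IH u le_d Qu.
have [umin|] := pselect (forall v, (v <= u)%MM -> Q v -> v = u).
  by exists u; split=> //; exact: lepm_refl.
move=> /existsNP [v /not_implyP [vu /not_implyP [Qv vnu]]].
have uE := submK vu.
have [|w [wv Qw wmin]] := IH v _ Qv.
  apply: leq_trans (le_d : mdeg u <= d)%N; rewrite -uE mdegD.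
  rewrite -[X in (X < _)%N]add0n ltn_add2r lt0n mdeg_eq0.
  by apply/eqP => uv0; apply: vnu; rewrite -uE uv0 add0m.
by exists w; split=> //; exact: lepm_trans vu.
Qed.

Lemma mcoeff_mulX_neq0 (c : {mpoly K[N]}) w u :
  (c * 'X_[w])@_u != 0 -> (w <= u)%MM.
Proof.
rewrite -mcoeff_msupp (perm_mem (msuppMX _ _)) => /mapP[v _ ->].
exact: lem_addr.
Qed.

(** Each monomial of an element of the ideal is a multiple of a minimal one, which gives generation.
    For irredundancy, a minimal ['X_[u]] written over a subset [G'] must occur in some product
    [c i * f i]; then the monomial [f i] divides ['X_[u]], so it equals ['X_[u]] by minimality. *)
Lemma minimally_generates_monomials :
  minimally_generates minimal_monomials
    [set q : {mpoly K[N]} | forall u, q@_u != 0 -> Q u].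
Proof.
split.
- apply/seteqP; split=> [_ [k [c [f [Gf ->]]]] u|q Hq] /=.
    rewrite raddf_sum /=; have [[i ciu]|c0] := pselect
      (exists i, (c i * f i)@_u != 0); last first.
      rewrite big1 ?eqxx // => i _; apply/eqP/negPn/negP => ciu.
      by apply: c0; exists i.
    move: ciu; have [w [-> Qw _]] := Gf i.
    by move=> /mcoeff_mulX_neq0 /Qup H _; apply: H.
  rewrite (mpolyE q) big_seq; apply: ideal_gen_sum => u; rewrite mcoeff_msupp.
  move=> /Hq /minimal_le [w [wu Qw wmin]].
  have [_ _ GM] := ideal_gen_closed minimal_monomials.
  rewrite -(submK wu) mpolyXD scalerAl; apply: GM.
  by apply: ideal_gen_mem; exists w.
- move=> G' G'G G'E; apply/seteqP; split=> // _ [u [-> Qu umin]].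
  have : ideal_gen G' 'X_[u].
    rewrite G'E /= => w; rewrite mcoeffX.
    by case: (eqVneq u w) => [<- //|_]; rewrite eqxx.
  move=> [k [c [f [G'f]]]] /(congr1 (mcoeff u)).
  rewrite mcoeffX eqxx raddf_sum /=.
  have [[i ciu]|c0] := pselect (exists i, (c i * f i)@_u != 0); last first.
    rewrite big1 => [/eqP|i _]; first by rewrite oner_eq0.
    by apply/eqP/negPn/negP => ciu; apply: c0; exists i.
  move=> _; have [w [fE Qw _]] := G'G _ (G'f i).
  by move: ciu (G'f i); rewrite fE => /mcoeff_mulX_neq0 /umin -> //.
Qed.

End MonomialIdeal.

(** * Polynomials that vanish at every point *)

Section Vanishing.
Variables (K : numFieldType) (N : nat).

(** In characteristic 0 the integers below [size q] are already too many distinct roots. *)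
Lemma poly_infinite_roots (q : {poly K}) : (forall t, q.[t] = 0) -> q = 0.
Proof.
move=> q0; apply: (@roots_geq_poly_eq0 _ _ [seq j%:R | j <- iota 0 (size q)]).
- by apply/allP => t _; rewrite rootE q0.
- by rewrite map_inj_uniq ?iota_uniq // => i j /eqP; rewrite eqr_nat => /eqP.
- by rewrite size_map size_iota.
Qed.

(** Uniqueness of digits in base [D], by reduction modulo [D]. It makes the exponents of Kronecker's
    substitution distinct. *)
Lemma digits_inj D k (u w : nat -> nat) :
  (forall j, (j < k)%N -> u j < D)%N -> (forall j, (j < k)%N -> w j < D)%N ->
  (\sum_(j < k) u j * D ^ j = \sum_(j < k) w j * D ^ j)%N ->
  forall j, (j < k)%N -> u j = w j.
Proof.
elim: k u w => // k IH u w uD wD.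
rewrite !big_ord_recl !expn0 !muln1.
have E (v : nat -> nat) : (\sum_(i < k) v (bump 0 i) * D ^ (bump 0 i) =
    (\sum_(i < k) v i.+1 * D ^ i) * D)%N.
  rewrite big_distrl; apply: eq_bigr => i _.
  by rewrite /bump /= add1n expnSr mulnA.
rewrite !E => uw.
have D0 : (0 < D)%N by apply: leq_ltn_trans (uD 0%N _).
have u0 : u 0%N = w 0%N.
  move/(congr1 (modn^~ D)): uw; rewrite addnC modnMDl addnC modnMDl.
  by rewrite !modn_small ?uD ?wD.
move: uw; rewrite u0 => /addnI /eqP; rewrite eqn_pmul2r // => /eqP E1 [|j] //.
rewrite ltnS.
apply: (IH (fun i => u i.+1) (fun i => w i.+1)) E1 j => i ik; first exact: uD.
exact: wD.
Qed.

(* Kronecker's substitution ['X_k |-> t ^ (D ^ k)] reduces to one variable. *)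
Lemma mpoly_vanish (p : {mpoly K[N]}) : (forall v, p.@[v] = 0) -> p = 0.
Proof.
(* This [D] exceeds the degree of every monomial of [p], so the exponents are digits in base [D]. *)
move=> p0; pose D := msize p.
pose wt (u : 'X_{1..N}) := (\sum_k u k * D ^ k)%N.
have wt_inj : {in msupp p &, injective wt}.
  move=> u w pu pw E; apply/mnmP => k.
  have lt (v : 'X_{1..N}) j : v \in msupp p -> (j < N)%N -> (nth 0 v j < D)%N.
    move=> pv jN; apply: leq_ltn_trans (msize_mdeg_lt pv).
    rewrite -(mnm_nth 0 v (Ordinal jN)) mdegE (bigD1 (Ordinal jN)) //=.
    exact: leq_addr.
  rewrite !(mnm_nth 0); apply: (@digits_inj D N (nth 0 u) (nth 0 w)) => //.
  - by move=> j; apply: lt.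
  - by move=> j; apply: lt.
  - by move: E; rewrite /wt; under eq_bigr do rewrite (mnm_nth 0);
      under [in RHS]eq_bigr do rewrite (mnm_nth 0).
pose q := \sum_(u <- msupp p) p@_u *: 'X^(wt u) : {poly K}.
have q0 : q = 0.
  apply: poly_infinite_roots => t; rewrite -[RHS](p0 (fun k => t ^+ (D ^ k))).
  rewrite mevalE horner_sum; apply: eq_bigr => u _.
  rewrite hornerZ hornerXn; congr (_ * _); rewrite /wt expr_sum.
  by apply: eq_bigr => k _; rewrite mulnC exprM.
apply/eqP; rewrite -msupp_eq0; apply/eqP.
case E : (msupp p) => [//|u s]; have pu : u \in msupp p by rewrite E mem_head.
(* As [wt] is injective on the support of [p], the coefficient of [q] at [wt u] is [p@_u] alone. *)
have := congr1 (fun q : {poly K} => q`_(wt u)) q0.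
rewrite coef0 coef_sum (bigD1_seq u) //= coefZ coefXn eqxx mulr1.
rewrite big_seq_cond big1 => [|w /andP[pw wu]].
  by rewrite addr0 => pu0; rewrite mcoeff_msupp pu0 eqxx in pu.
rewrite coefZ coefXn; case: eqVneq => [/wt_inj E'|]; last by rewrite mulr0.
by rewrite (E' pu pw) eqxx in wu.
Qed.

End Vanishing.

(** * Changes of coordinates *)

Section AdaptedBasis.
Variables (F : fieldType) (n m : nat) (U : 'I_m -> {vspace 'rV[F]_n.+1}).
Hypothesis dimU : forall i, \dim (U i) = 2%N.
Hypothesis dim_sumU : \dim (\sum_i U i)%VS = (2 * m)%N.

(** The rows of [B] are the concatenated bases of the planes [U i], completed to a basis of the
    whole space. The dimension of the sum makes the planes independent, and rows [2i] and [2i + 1]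
    span [U i]. *)
Lemma adapted_basis : exists B : 'M[F]_n.+1, B \in unitmx /\
  forall i (w : 'rV_n.+1),
    w *m B \in U i <-> (forall k : 'I_n.+1, k./2 != i -> w 0 k = 0).
Proof.
have dimV : \dim {: 'rV[F]_n.+1} = n.+1 by rewrite dimvf /dim /= mul1n.
have le_2m : (2 * m <= n.+1)%N.
  by have := dimvS (subvf (\sum_i U i)); rewrite dimV dim_sumU.
(* The case without planes is set apart because [inord] needs a nonempty index type. *)
case: m U dimU dim_sumU le_2m => [|m'] V dimV2 dim_sumV le_2m.
  by exists 1%:M; rewrite unitmx1; split=> // [[]].
pose X := [seq (vbasis (V (inord k./2)))`_(odd k) | k <- iota 0 (2 * m'.+1)].
have szX : size X = (2 * m'.+1)%N by rewrite size_map size_iota.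
have nthX (k : nat) : (k < 2 * m'.+1)%N ->
    X`_k = (vbasis (V (inord k./2)))`_(odd k).
  by move=> lk; rewrite (nth_map 0%N) ?size_iota // nth_iota.
have ltX (i : 'I_m'.+1) (b : bool) : (i.*2 + b < 2 * m'.+1)%N.
  by rewrite mul2n; case: b; rewrite ?addn1 ?addn0 ?ltn_Sdouble ?ltn_double.
have XV (i : 'I_m'.+1) (b : bool) : X`_(i.*2 + b) = (vbasis (V i))`_b.
  rewrite nthX // addnC half_bit_double inord_val oddD odd_double addbF.
  by case: b.
(* The dimension is at most the length of [X], and at least that of the sum, since the span contains
   every [V i]. *)
have dimX : \dim <<X>> = (2 * m'.+1)%N.
  apply/eqP; rewrite eqn_leq -{1}szX dim_span -dim_sumV dimvS //.
  apply/subv_sumP => i _; rewrite -{1}(span_basis (vbasisP (V i))).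
  apply: sub_span => v /(nthP 0) [j]; rewrite size_tuple => lj <-.
  rewrite dimV2 in lj.
  have -> : j = (j == 1%N) :> nat by case: j lj => [|[]].
  by rewrite -XV mem_nth // szX.
pose Y := X ++ vbasis (<<X>>^C)%VS.
have szY : size Y = n.+1.
  by rewrite size_cat szX size_tuple dimv_compl dimX dimV subnKC.
have spanY : <<in_tuple Y>>%VS = fullv.
  by rewrite /= span_cat (span_basis (vbasisP _)) addv_complf.
pose B := \matrix_(k < n.+1) Y`_k.
have mulB (w : 'rV_n.+1) : w *m B = \sum_k w 0 k *: Y`_k.
  by rewrite mulmx_sum_row; apply: eq_bigr => k _; rewrite rowK.
have uB : B \in unitmx.
  (* The rows of [W] expand the standard basis in the spanning family [Y], so [W] is a left inverse
     of [B]. *)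
  pose W : 'M_n.+1 :=
    \matrix_k \row_j coord (in_tuple Y) (cast_ord (esym szY) j) (delta_mx 0 k).
  suff /mulmx1_unit[] : W *m B = 1%:M by [].
  apply/row_matrixP => k; rewrite row_mul rowK row1 mulB.
  rewrite [RHS](@coord_span _ _ _ (in_tuple Y)) ?spanY ?memvf //.
  rewrite (reindex (cast_ord szY)) /=; last first.
    by exists (cast_ord (esym szY)) => j _; rewrite ?cast_ordK ?cast_ordKV.
  by apply: eq_bigr => j _; rewrite mxE cast_ordK.
exists B; split=> // i w; split.
- move=> wBi; rewrite -{1}(span_basis (vbasisP (V i))) in wBi.
  pose kk (j : 'I_(\dim (V i))) : 'I_n.+1 := inord (i.*2 + (j == 1%N :> nat)).
  pose w' : 'rV_n.+1 :=
    \sum_j coord (vbasis (V i)) j (w *m B) *: delta_mx 0 (kk j).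
  have kkE j : kk j = (i.*2 + (j == 1%N :> nat))%N :> nat.
    by rewrite inordK // (leq_trans (ltX _ _)).
  have -> : w = w'.
    apply: (can_inj (mulmxK uB)); rewrite (coord_span wBi) mulmx_suml.
    apply: eq_bigr => j _; rewrite -scalemxAl -rowE rowK kkE nth_cat szX ltX XV.
    
    have: (j < 2)%N by rewrite -(dimV2 i).
    by case: (nat_of_ord j) => [|[]].
  move=> k ki; rewrite summxE big1 // => j _; rewrite !mxE eqxx /=.
  case: eqVneq => [kE|]; last by rewrite mulr0.
  by move: ki; rewrite kE kkE addnC half_bit_double eqxx.
- move=> w0; rewrite mulB memv_suml // => k _.
  have [ki|/w0 ->] := eqVneq (k./2) i; last by rewrite scale0r mem0v.
  have kE : (k : nat) = (i.*2 + odd k)%N by rewrite -ki addnC odd_double_half.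
  rewrite memvZ // kE nth_cat szX ltX XV.
  by rewrite vbasis_mem // mem_nth // size_tuple dimV2; case: (odd k).
Qed.

End AdaptedBasis.

Section LinearSubst.
Variables (R : realType) (n : nat).
Local Notation C := (R[i]).
Local Notation S := {mpoly C[n.+1]}.
Implicit Types (M : 'M[C]_n.+1) (p q : S).

Lemma linear_substU M k : linear_subst M 'X_k = \sum_j M k j *: 'X_j.
Proof. by rewrite /linear_subst comp_mpolyXU -tnth_nth tnth_mktuple. Qed.

Lemma linear_substM M p q :
  linear_subst M (p * q) = linear_subst M p * linear_subst M q.
Proof. exact: rmorphM. Qed.

Lemma linear_substZ M c p : linear_subst M (c *: p) = c *: linear_subst M p.
Proof. exact: comp_mpolyZ. Qed.

Lemma linear_subst_sum M (I : Type) (r : seq I) (P : pred I) (F : I -> S) :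
  linear_subst M (\sum_(i <- r | P i) F i)
    = \sum_(i <- r | P i) linear_subst M (F i).
Proof. exact: (big_morph _ (comp_mpolyD _) (comp_mpoly0 _)). Qed.

Lemma linear_subst_prod M (I : Type) (r : seq I) (P : pred I) (F : I -> S) :
  linear_subst M (\prod_(i <- r | P i) F i)
    = \prod_(i <- r | P i) linear_subst M (F i).
Proof. exact: (big_morph _ (linear_substM _) (comp_mpoly1 _)). Qed.

Lemma linear_substXn M p d : linear_subst M (p ^+ d) = linear_subst M p ^+ d.
Proof. exact: rmorphXn. Qed.

Lemma linear_subst_meval M p v :
  (linear_subst M p).@[v] = p.@[fun i => \sum_j M i j * v j].
Proof.
rewrite /linear_subst comp_mpoly_meval; apply: meval_eq => i.
rewrite tnth_mktuple raddf_sum /=; apply: eq_bigr => j _.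
by rewrite mevalZ mevalXU.
Qed.

Lemma linear_subst1 p : linear_subst 1%:M p = p.
Proof.
rewrite /linear_subst.
have -> : [tuple \sum_j (1%:M : 'M[C]_n.+1) i j *: 'X_j | i < n.+1] =
    [tuple 'X_i | i < n.+1] :> n.+1.-tuple S.
  apply: eq_from_tnth => i; rewrite !tnth_mktuple (bigD1 i) //=.
  rewrite mxE eqxx scale1r.
  by rewrite big1 ?addr0 // => j ji; rewrite mxE eq_sym (negPf ji) scale0r.
exact: comp_mpoly_id.
Qed.

(* Otherwise unification unfolds both sides down to sums over [msupp]. *)
Local Opaque linear_subst.

(** Both sides are ring morphisms fixing the constants, so the identity reduces through monomials
    and powers to the variables, where it is the matrix product. *)
Lemma linear_subst_comp M M' p :
  linear_subst M' (linear_subst M p) = linear_subst (M *m M') p.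
Proof.
rewrite (mpolyE p) (linear_subst_sum M) (linear_subst_sum M') linear_subst_sum;
  apply: eq_bigr => u _.
rewrite (linear_substZ M) (linear_substZ M') (linear_substZ (M *m M')).
suff -> : linear_subst M' (linear_subst M 'X_[u]) =
  linear_subst (M *m M') 'X_[u] by [].
rewrite (mpolyXE_id _ u).
rewrite (linear_subst_prod M) (linear_subst_prod M') linear_subst_prod.
apply: eq_bigr => k _.
rewrite (linear_substXn M) (linear_substXn M') linear_substXn.
suff -> : linear_subst M' (linear_subst M 'X_k) =
  linear_subst (M *m M') 'X_k by [].
rewrite (linear_substU M) (linear_substU (M *m M')) linear_subst_sum.
under eq_bigr => j _ do rewrite linear_substZ linear_substU scaler_sumr.
rewrite exchange_big; apply: eq_bigr => j _.
by rewrite mxE scaler_suml; apply: eq_bigr => i _; rewrite scalerA.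
Qed.

Lemma linear_substK M : M \in unitmx ->
  cancel (linear_subst M) (linear_subst (invmx M)).
Proof. by move=> uM p; rewrite linear_subst_comp mulmxV // linear_subst1. Qed.

Lemma linear_substVK M : M \in unitmx ->
  cancel (linear_subst (invmx M)) (linear_subst M).
Proof. by move=> uM p; rewrite linear_subst_comp mulVmx // linear_subst1. Qed.

Lemma linear_substU_homog M k : linear_subst M 'X_k \is 1.-homog.
Proof.
rewrite linear_substU; apply: rpred_sum => j _.
by apply: rpredZ; rewrite dhomogX /= mdeg1.
Qed.

(** The transpose appears because evaluating [linear_subst B^T p] at [w] evaluates [p] at [w *m B].
    Points of the line are thus the points whose coordinates outside [P] are zero. *)
Lemma line_idealP (l : line R n) (B : 'M[C]_n.+1) (P : pred 'I_n.+1) p :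
  B \in unitmx -> (exists k, P k) ->
  (forall w, w *m B \in line_space l <-> (forall k, ~~ P k -> w 0 k = 0)) ->
  line_ideal l p <-> restr P (linear_subst B^T p) = 0.
Proof.
move=> uB [a Pa] Bl; split=> [/line_ideal_vanishes pl|].
(* Vanishing on the line says nothing at the zero vector. The factor ['X_a] takes care of the points
   with [v a = 0]; at the others the projection [w] is nonzero. *)
- suff : 'X_a * restr P (linear_subst B^T p) = 0.
    by move/eqP; rewrite mulf_eq0 (negPf (mpolyU_neq0 _ _)) => /eqP.
  apply: mpoly_vanish => v; rewrite mevalM mevalXU.
  have [->|va] := eqVneq (v a) 0; first by rewrite mul0r.
  pose w : 'rV[C]_n.+1 := \row_k if P k then v k else 0.
  have w0 : w != 0.
    by apply: contraNneq va => /rowP /(_ a); rewrite !mxE Pa => ->.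
  have := pl (w *m B); rewrite Bl => H.
  rewrite /restr comp_mpoly_meval linear_subst_meval.
  rewrite (@meval_eq _ _ _ (fun i => (w *m B) 0 i)) => [|i].
    rewrite H ?mulr0 // => [k nPk|]; first by rewrite mxE (negPf nPk).
    by apply: contra w0 => /eqP wB0; rewrite -(mulmxK uB w) wB0 mul0mx.
  rewrite mxE; apply: eq_bigr => j _; rewrite !mxE tnth_mktuple mulrC.
  by case: ifP; rewrite ?mevalXU ?meval0.
(* Conversely, [p] is a combination of the pullbacks of the variables outside [P], which are linear
   forms vanishing on the line. *)
- move=> /restr_eq0_ideal [c pE].
  have uBT : B^T \in unitmx by rewrite unitmx_tr.
  rewrite -(linear_substK uBT p) pE linear_subst_sum.
  apply: ideal_gen_sum => k nPk; rewrite linear_substM.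
  have [_ _ GM] := ideal_gen_closed
    [set f | (exists d, f \is d.-homog) /\ vanishes_on l f].
  apply: GM; apply: ideal_gen_mem; split.
    by exists 1%N; exact: linear_substU_homog.
  move=> v vl _; rewrite linear_subst_meval mevalXU.
  have /Bl /(_ _ nPk) : v *m invmx B *m B \in line_space l by rewrite mulmxKV.
  rewrite mxE => E; rewrite -[RHS]E; apply: eq_bigr => j _.
  by rewrite -trmx_inv mxE mulrC.
Qed.

End LinearSubst.

(** * Linear resolutions over a fiber product of polynomial rings *)

Section RowVectors.
Variable A : comNzRingType.

Lemma row_mx_eq0 p q (a : 'rV[A]_p) (b : 'rV[A]_q) :
  row_mx a b = 0 <-> a = 0 /\ b = 0.
Proof.
split=> [|[-> ->]]; last exact: row_mx0.
by rewrite -[0]row_mx0 => /eq_row_mx.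
Qed.

Lemma scalar_mx00 (a : A) : (a%:M : 'M[A]_1) 0 0 = a.
Proof. by rewrite mxE eqxx mulr1n. Qed.

Lemma addmx00 (a b : 'M[A]_1) : (a + b) 0 0 = a 0 0 + b 0 0.
Proof. exact: mxE. Qed.

Lemma mul_rV1 (u : 'rV[A]_1) a : u *m (a%:M : 'M[A]_1) = (u 0 0 * a)%:M.
Proof. by rewrite {1}[u]mx11_scalar -scalar_mxM. Qed.

Lemma scalar_mx1_eq0 (a : A) : (a%:M : 'M[A]_1) = 0 <-> a = 0.
Proof.
by split=> [/matrixP /(_ 0 0)|->]; rewrite ?raddf0 // !mxE eqxx mulr1n.
Qed.

Lemma mul_rV1_eq0 (u : 'rV[A]_1) a :
  u *m (a%:M : 'M[A]_1) = 0 <-> u 0 0 * a = 0.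
Proof. by rewrite mul_rV1 scalar_mx1_eq0. Qed.

Lemma mul_fork_mx p q (a b : 'M[A]_(p, 1)) (d : 'M[A]_(q, 1)) w :
  w *m col_mx (row_mx a b) (block_mx d 0 0 d) =
  row_mx (lsubmx w *m a + lsubmx (rsubmx w) *m d)
         (lsubmx w *m b + rsubmx (rsubmx w) *m d) :> 'rV_(1 + 1).
Proof.
rewrite -{1}[w]hsubmxK -{1}[rsubmx w]hsubmxK mul_row_col mul_row_block !mulmx0.
by rewrite addr0 add0r mul_mx_row add_row_mx.
Qed.

End RowVectors.

Section FiberProduct.
Variables (A : comNzRingType) (gr : nat -> set A) (m : nat) (x y : 'I_m -> A).

(** The ideal generated by the [x i] and [y i] with [i] in [s], in recursive form so that its cover
    can be built one pair at a time. *)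
Fixpoint span_pairs (s : seq 'I_m) (z : A) : Prop :=
  if s is i :: s' then
    exists a b z', span_pairs s' z' /\ z = a * x i + b * y i + z'
  else z = 0.

Lemma span_pairs0 s : span_pairs s 0.
Proof.
elim: s => //= i s IH; exists 0, 0, 0.
by split=> //; rewrite !mul0r !addr0.
Qed.

Lemma span_pairsD s z w :
  span_pairs s z -> span_pairs s w -> span_pairs s (z + w).
Proof.
elim: s z w => /= [z w -> ->|i s IH z w]; first exact: addr0.
case=> [a [b [z' [Hz ->]]]] [c [d [w' [Hw ->]]]].
exists (a + c), (b + d), (z' + w'); split; first exact: IH.
by rewrite !mulrDl addrACA; congr (_ + _); rewrite addrACA.
Qed.

Lemma span_pairsM s a z : span_pairs s z -> span_pairs s (a * z).
Proof.
elim: s z => /= [z ->|i s IH z]; first exact: mulr0.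
case=> [b [c [z' [Hz ->]]]]; exists (a * b), (a * c), (a * z').
by split; [exact: IH|rewrite !mulrDr !mulrA].
Qed.

Lemma span_pairs_mem s i : i \in s -> span_pairs s (x i) /\ span_pairs s (y i).
Proof.
elim: s => //= j s IH; rewrite inE => /orP[/eqP <-|/IH [sx sy]].
- split; [exists 1, 0, 0|exists 0, 1, 0]; split; try exact: span_pairs0.
    by rewrite mul1r mul0r !addr0.
  by rewrite mul1r mul0r add0r addr0.
- split; [exists 0, 0, (x i)|exists 0, 0, (y i)];
    by split=> //; rewrite !mul0r !add0r.
Qed.

Hypotheses (gr0 : gr 1 0) (grN : forall a, gr 1 a -> gr 1 (- a)).
Hypotheses (grx : forall i, gr 1 (x i)) (gry : forall i, gr 1 (y i)).
(** The fiber product enters through these properties. With [xx0] and [xy0], [annxy] and [ann_span]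
    identify the common annihilator of [x i] and [y i] with the sum of the other ideals m_j. By
    [syzygy_xy] the Koszul syzygy is the only one modulo this annihilator, and by [pair_ann] the
    annihilator meets m_i in 0. *)
Hypothesis xx0 : forall i j, i != j -> x i * x j = 0.
Hypothesis xy0 : forall i j, i != j -> x i * y j = 0.
Hypothesis annxy : forall i u, u * x i = 0 <-> u * y i = 0.
Hypothesis ann_span : forall i u, u * x i = 0 ->
  span_pairs (rem i (enum 'I_m)) u.
Hypothesis syzygy_xy : forall i a b, a * x i + b * y i = 0 ->
  exists c, (a - c * y i) * x i = 0 /\ (b + c * x i) * x i = 0.
Hypothesis pair_ann : forall i a b, (a * x i + b * y i) * x i = 0 ->
  a * x i + b * y i = 0.
Hypothesis irrelevant_span : forall a,
  irrelevant_ideal gr a <-> span_pairs (enum 'I_m) a.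

Lemma span_pairs_ann i s z : i \notin s -> span_pairs s z -> z * x i = 0.
Proof.
elim: s z => [|j s IH] z /=; first by move=> _ ->; rewrite mul0r.
rewrite inE negb_or => /andP[ij ins] [a [b [z' [/(IH _ ins) z'0 ->]]]].
rewrite !mulrDl z'0 addr0 -!mulrA xx0 1?eq_sym // (mulrC (y j)) xy0 //.
by rewrite !mulr0 addr0.
Qed.

Lemma ann_spanE i z : z * x i = 0 <-> span_pairs (rem i (enum 'I_m)) z.
Proof.
split=> [|zs]; first exact: ann_span.
by apply: span_pairs_ann zs; rewrite mem_rem_uniqF ?enum_uniq.
Qed.

Definition pair_mx i : 'M[A]_(1 + 1, 1) := col_mx (x i)%:M (y i)%:M.

(* The first syzygy modules of direct sums of the modules A_i (one generator)
   and m_i (two generators). *)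
Inductive good : forall p, ('rV[A]_p -> Prop) -> Prop :=
| good_full : @good 0 (fun=> True)
| good_ann i : @good 1 (fun u => u *m (x i)%:M = 0)
| good_pair i : @good (1 + 1) (fun u => u *m pair_mx i = 0)
| good_prod p q (Z1 : 'rV_p -> Prop) (Z2 : 'rV_q -> Prop) :
    good Z1 -> good Z2 ->
    @good (p + q) (fun u => Z1 (lsubmx u) /\ Z2 (rsubmx u))
| good_ext p (Z Z' : 'rV_p -> Prop) :
    (forall u, Z u <-> Z' u) -> good Z -> good Z'.

(** One step of a linear resolution: [Z] is the image of a matrix of linear forms whose kernel is
    again in the class [good]. *)
Definition covered p (Z : 'rV[A]_p -> Prop) := exists q (d : 'M[A]_(q, p)),
  [/\ forall i j, gr 1 (d i j),
      forall u, (exists w, u = w *m d) <-> Z u &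
      good (fun w => w *m d = 0)].

Lemma gr_col p q r (d : 'M[A]_(p, r)) (e : 'M[A]_(q, r)) :
  (forall i j, gr 1 (d i j)) -> (forall i j, gr 1 (e i j)) ->
  forall i j, gr 1 (col_mx d e i j).
Proof. by move=> Hd He i j; rewrite mxE; case: (fintype.split i). Qed.

Lemma gr_row p q r (d : 'M[A]_(r, p)) (e : 'M[A]_(r, q)) :
  (forall i j, gr 1 (d i j)) -> (forall i j, gr 1 (e i j)) ->
  forall i j, gr 1 (row_mx d e i j).
Proof. by move=> Hd He i j; rewrite mxE; case: (fintype.split j). Qed.

Lemma gr_scalar a : gr 1 a -> forall i j, gr 1 ((a%:M : 'M[A]_1) i j).
Proof. by move=> ga i j; rewrite !ord1 mxE eqxx mulr1n. Qed.

Lemma gr_zero p q i j : gr 1 ((0 : 'M[A]_(p, q)) i j).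
Proof. by rewrite mxE. Qed.

Lemma mul_pair_mx (u : 'rV[A]_(1 + 1)) i :
  u *m pair_mx i = (lsubmx u 0 0 * x i + rsubmx u 0 0 * y i)%:M.
Proof.
by rewrite -{1}[u]hsubmxK mul_row_col !mul_rV1 -raddfD.
Qed.

(** The ideal is the direct sum of the m_i for [i] in [s], so its syzygies are the product of those
    of the summands. *)
Lemma covered_span s : uniq s -> @covered 1 (fun u => span_pairs s (u 0 0)).
Proof.
elim: s => [_|i s IH /= /andP[ins us]].
  exists 0%N, 0; split=> [i j|u|]; first by case: i.
    split=> [[w ->]|/= u0]; first by rewrite mulmx0 mxE.
    by exists 0; rewrite [u]mx11_scalar u0 mulmx0 raddf0.
  by apply: good_ext good_full => u; rewrite mulmx0.
have [q [d [dl dE dg]]] := IH us.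
exists ((1 + 1) + q)%N, (col_mx (pair_mx i) d); split.
- by apply: gr_col => //; apply: gr_col; exact: gr_scalar.
- move=> u; split=> [[w ->]|[a [b [z [zs uE]]]]].
    rewrite -[w]hsubmxK mul_row_col mul_pair_mx mxE [X in X + _]mxE eqxx mulr1n.
    do 3 eexists; split; last reflexivity.
    by apply/dE; eexists.
  have [|w wE] := (dE z%:M).2; first by rewrite mxE eqxx mulr1n.
  exists (row_mx (row_mx a%:M b%:M) w); rewrite mul_row_col mul_pair_mx -wE.
  by rewrite row_mxKl row_mxKr !mxE !eqxx !mulr1n [LHS]mx11_scalar uE -raddfD.
- apply: good_ext (good_prod (good_pair i) dg) => w.
  rewrite -{3}[w]hsubmxK mul_row_col.
  split=> [[-> ->]|w0]; first by rewrite addr0.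
  (* The sum is direct: the part in m_i is opposite to an element of the other m_j, so [x i] kills
     it, and it vanishes by [pair_ann]. *)
  suff E : lsubmx w *m pair_mx i = 0 by move: w0; rewrite E add0r.
  move: w0; rewrite mul_pair_mx => /matrixP /(_ 0 0).
  rewrite addmx00 scalar_mx00 [RHS]mxE => w0.
  rewrite pair_ann ?raddf0 //.
  have /(span_pairs_ann ins) E : span_pairs s ((rsubmx w *m d) 0 0).
    by apply/dE; eexists.
  move: w0 => /eqP; rewrite addr_eq0 => /eqP ->.
  by rewrite mulNr E ?oppr0.
Qed.

Lemma covered_ann i : @covered 1 (fun u => u *m (x i)%:M = 0).
Proof.
have [q [d [dl dE dg]]] :=
  covered_span (rem_uniq i (enum_uniq 'I_m)).
exists q, d; split=> // u; apply: (iff_trans (dE u)).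
by rewrite mul_rV1_eq0 ann_spanE.
Qed.

(** Generators are the Koszul syzygy and two copies of the generators [d] of the annihilator of
    [x i]. The relations among them decouple: the coefficient of the Koszul syzygy lies in that
    annihilator, and the rest is two copies of the kernel of [d]. *)
Lemma covered_pair i : @covered (1 + 1) (fun u => u *m pair_mx i = 0).
Proof.
have [q [d [dl dE dg]]] := covered_ann i.
have dx (w : 'rV[A]_q) : (w *m d) 0 0 * x i = 0.
  by rewrite -mul_rV1_eq0; apply/dE; exists w.
have dy (w : 'rV[A]_q) : (w *m d) 0 0 * y i = 0 by apply/annxy.
exists (1 + (q + q))%N.
exists (col_mx (row_mx (y i)%:M (- x i)%:M) (block_mx d 0 0 d)); split.
- apply: gr_col; first by apply: gr_row; apply: gr_scalar => //; exact: grN.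
  by apply: gr_col; apply: gr_row => //; exact: gr_zero.
- move=> u; split=> [[w ->]|].
    rewrite mul_fork_mx mul_pair_mx row_mxKl row_mxKr.
    rewrite !mul_rV1 !addmx00 !scalar_mx00 !mulrDl dx dy !addr0.
    by rewrite mulrN mulNr mulrAC subrr raddf0.
  (* Subtracting [c] times the Koszul syzygy leaves two coordinates killed by [x i], which lift
     along [d] to [w1] and [w2]. *)
  rewrite mul_pair_mx scalar_mx1_eq0 => /syzygy_xy [c [cl cr]].
  have [w1 w1E] := (dE (lsubmx u 0 0 - c * y i)%:M).2
    ((mul_rV1_eq0 _ _).2 (etrans (congr1 ( *%R^~ _) (scalar_mx00 _)) cl)).
  have [w2 w2E] := (dE (rsubmx u 0 0 + c * x i)%:M).2
    ((mul_rV1_eq0 _ _).2 (etrans (congr1 ( *%R^~ _) (scalar_mx00 _)) cr)).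
  exists (row_mx c%:M (row_mx w1 w2)).
  rewrite mul_fork_mx !(row_mxKl, row_mxKr) -w1E -w2E !mul_rV1 !scalar_mx00.
  rewrite -!raddfD /= addrC subrK mulrN.
  by rewrite addrC addrK -!mx11_scalar hsubmxK.
- apply: good_ext (good_prod (good_ann i) (good_prod dg dg)) => w.
  rewrite /= mul_fork_mx row_mx_eq0 mul_rV1_eq0 !mul_rV1.
  split=> [[w0 [-> ->]]|[wl wr]].
    by rewrite !addr0 mulrN w0 oppr0 (annxy _ _).1 // raddf0.
  suff w0 : lsubmx w 0 0 * x i = 0.
    split=> //.
    move: wl wr; rewrite mulrN w0 oppr0 (annxy _ _).1 // raddf0 !add0r.
    by split.
  (* Multiplication by [x i] removes the contribution of [d]; the remaining multiple of [y i] lies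
     in m_i and is killed by [x i], so it is zero. *)
  move/matrixP: wl => /(_ 0 0); rewrite addmx00 scalar_mx00 [RHS]mxE => wl.
  have : (lsubmx w 0 0 * y i) * x i = 0.
    move/eqP: wl; rewrite addr_eq0 => /eqP ->.
    by rewrite mulNr dx oppr0.
  move=> H; apply/annxy.
  have := @pair_ann i 0 (lsubmx w 0 0); rewrite mul0r add0r; exact.
Qed.

(** The class is stable under linear syzygies, so covers can be iterated forever; a product is
    covered by a block diagonal matrix. *)
Lemma covered_good p (Z : 'rV[A]_p -> Prop) : good Z -> covered Z.
Proof.
elim=> {p Z} [|i|i|p q Z1 Z2 _ [p' [d [dl dE dg]]] _ [q' [e [el eE eg]]]|
  p Z Z' ZZ' _ [q [d [dl dE dg]]]].
- exists 0%N, 0; split=> [[]//|u|].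
    by split=> // _; exists 0; apply/matrixP => ? [].
  apply: good_ext good_full => w; split=> // _.
  by apply/matrixP => ? [].
- exact: covered_ann.
- exact: covered_pair.
- exists (p' + q')%N, (block_mx d 0 0 e); split.
  + by apply: gr_col; apply: gr_row => //; exact: gr_zero.
  + move=> u; rewrite -dE -eE; split=> [[w ->]|[[w1 E1] [w2 E2]]].
      rewrite -[w]hsubmxK mul_row_block !mulmx0 addr0 add0r row_mxKl row_mxKr.
      by split; eexists.
    exists (row_mx w1 w2); rewrite mul_row_block !mulmx0 addr0 add0r.
    by rewrite -E1 -E2 hsubmxK.
  + apply: good_ext (good_prod dg eg) => w.
    by rewrite -{3}[w]hsubmxK mul_row_block !mulmx0 addr0 add0r row_mx_eq0.
- by exists q, d; split=> // u; rewrite dE.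
Qed.

Lemma fiber_product_koszul : koszul gr.
Proof.
(* A state of the construction is a syzygy module with its rank. It records [covered] because the
   initial state, the irrelevant ideal, is treated directly by [covered_span]. *)
pose T := {p : nat & {Z : 'rV[A]_p -> Prop | covered Z}}.
have next (t : T) : {t' : T & {d : 'M[A]_(tag t', tag t) |
    [/\ forall i j, gr 1 (d i j),
        forall u, (exists w, u = w *m d) <-> sval (tagged t) u
      & forall w, sval (tagged t') w <-> w *m d = 0]}}.
  case: t => p [Z cZ] /=.
  have [q qP] := cid cZ; have [d [dl dE dg]] := cid qP.
  by exists (existT _ q (exist _ _ (covered_good dg))), d; split.
have c0 : @covered 1 (fun u => forall k, irrelevant_ideal gr (u 0 k)).
  have [q [d [dl dE dg]]] := covered_span (enum_uniq 'I_m).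
  exists q, d; split=> // u; apply: (iff_trans (dE u)).
  split=> [us k|/(_ 0)]; last by move/irrelevant_span.
  by rewrite ord1; apply/irrelevant_span.
(* The resolution arises by repeatedly choosing a cover and passing to its kernel. *)
pose t := fix t i : T := if i is j.+1 then projT1 (next (t j)) else
  existT _ 1%N (exist _ _ c0).
exists (fun i => tag (t i)), (fun i => sval (projT2 (next (t i)))).
split=> //.
- by move=> i; have [] := svalP (projT2 (next (t i))).
- by have [_ E _] := svalP (projT2 (next (t 0%N))).
- move=> i u; have [_ E _] := svalP (projT2 (next (t i.+1))).
  have [_ _ E'] := svalP (projT2 (next (t i))).
  exact: iff_trans (E u) (E' u).
Qed.

End FiberProduct.

(** * The quotient of a polynomial ring attached to blocks of two variables *)

Definition block n (i : nat) : pred 'I_n.+1 := fun k => k./2 == i.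

Section Blocks.
Variables (K : fieldType) (n m : nat).
Hypothesis le_2m : (2 * m <= n.+1)%N.
Local Notation S := {mpoly K[n.+1]}.
Local Notation blk := (@block n).

Definition vx (i : 'I_m) : 'I_n.+1 := inord i.*2.
Definition vy (i : 'I_m) : 'I_n.+1 := inord i.*2.+1.

Lemma vxE i : vx i = i.*2 :> nat.
Proof.
rewrite inordK // (leq_trans _ le_2m) // mul2n.
by rewrite ltn_double.
Qed.

Lemma vyE i : vy i = i.*2.+1 :> nat.
Proof. by rewrite inordK // (leq_trans _ le_2m) // mul2n ltn_Sdouble. Qed.

Lemma block_vx i j : blk j (vx i) = (i == j :> nat).
Proof. by rewrite /block vxE doubleK. Qed.

Lemma block_vy i j : blk j (vy i) = (i == j :> nat).
Proof. by rewrite /block vyE /= uphalf_double. Qed.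

Lemma vx_neq_vy i : vx i != vy i.
Proof. by rewrite -val_eqE /= vxE vyE neq_ltn ltnSn. Qed.

Lemma block_cases (k : 'I_n.+1) : (k < 2 * m)%N ->
  exists2 i : 'I_m, blk i k & k = vx i \/ k = vy i.
Proof.
rewrite mul2n -ltn_half_double => km; exists (Ordinal km); first exact: eqxx.
have kE := odd_double_half k.
case: (odd k) kE => /= kE; [right|left]; apply: val_inj => /=.
  by rewrite vyE.
by rewrite vxE.
Qed.

(** [A] is presented abstractly as the quotient of [S] by the polynomials that restrict to zero on
    all blocks; leaving [sigma] free allows it to include a change of coordinates. *)
Variables (A : comNzRingType) (gr : nat -> set A) (sigma : {rmorphism S -> A}).
Hypothesis sigma_surj : forall a, exists q, a = sigma q.
Hypothesis sigma_eq0 : forall q,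
  sigma q = 0 <-> (forall i : 'I_m, restr (blk i) q = 0).
Hypotheses (gr0 : gr 1 0) (grN : forall a, gr 1 a -> gr 1 (- a)).
Hypothesis gr_sigmaX : forall k, gr 1 (sigma 'X_k).
Hypothesis gr_pos : forall d a, (0 < d)%N -> gr d a ->
  exists2 q, q@_0%MM = 0 & a = sigma q.

(** A variable of block [i] restricts to zero on the other blocks and to a nonzerodivisor on its
    own. Hence both variables of a block have the same annihilator. *)
Lemma sigma_mulX (i : 'I_m) k q : blk i k ->
  sigma q * sigma 'X_k = 0 <-> restr (blk i) q = 0.
Proof.
move=> ik; rewrite -rmorphM sigma_eq0; split=> [/(_ i)/eqP|q0 j].
  by rewrite restrM restrU ik mulf_eq0 (negPf (mpolyU_neq0 _ _)) orbF => /eqP.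
rewrite restrM restrU; case: ifP => [jk|]; last by rewrite mulr0.
by rewrite -(eqP jk) (eqP ik) q0 mul0r.
Qed.

Lemma sigma_var0 (k : 'I_n.+1) : ~~ (k < 2 * m)%N -> sigma 'X_k = 0.
Proof.
move=> km; apply/sigma_eq0 => i; rewrite restrU /block; case: eqP => // ki.
case/negP: km; rewrite mul2n -ltn_half_double ki.
exact: ltn_ord.
Qed.

Let x i := sigma 'X_(vx i).
Let y i := sigma 'X_(vy i).

(** [q] is a combination of variables outside [P]. Those of index at least [2 * m] become zero in
    [A], and the others belong to pairs listed in [s]. *)
Lemma span_pairs_restr (P : pred 'I_n.+1) (s : seq 'I_m) q :
  (forall (i : 'I_m) k, blk i k -> ~~ P k -> i \in s) ->
  restr P q = 0 -> span_pairs x y s (sigma q).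
Proof.
move=> sP /restr_eq0_ideal [c ->]; rewrite rmorph_sum /=.
apply: (big_ind (span_pairs x y s)) => [||k nPk].
- exact: span_pairs0.
- by move=> *; exact: span_pairsD.
rewrite rmorphM; apply: span_pairsM.
case: (boolP (k < 2 * m)%N) => [/block_cases [i ik kE]|/sigma_var0 ->].
  have [sx sy] := span_pairs_mem x y (sP _ _ ik nPk).
  by case: kE => ->.
exact: span_pairs0.
Qed.

Lemma blocks_koszul : koszul gr.
Proof.
have xx0 (i j : 'I_m) k l : i != j -> blk i k -> blk j l ->
    sigma 'X_k * sigma 'X_l = 0.
  move=> ij ik jl; apply/(sigma_mulX _ jl) => //; rewrite restrU.
  case: ifP => // jk; case/eqP: ij; apply: val_inj => /=.
  by rewrite -(eqP ik) -(eqP jk).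
have bxi (i : 'I_m) : blk i (vx i) by rewrite block_vx.
have byi (i : 'I_m) : blk i (vy i) by rewrite block_vy.
apply: (@fiber_product_koszul A gr m x y) => //.
- by move=> i; exact: gr_sigmaX.
- by move=> i; exact: gr_sigmaX.
- by move=> i j ij; apply: (xx0 i j).
- by move=> i j ij; apply: (xx0 i j).
- move=> i u; have [q ->] := sigma_surj u.
  by rewrite !(@sigma_mulX i).
- move=> i u; have [q ->] := sigma_surj u.
  rewrite (@sigma_mulX i) //; apply: span_pairs_restr => j k jk nik.
  rewrite mem_rem_uniq ?enum_uniq // inE mem_enum andbT.
  by apply: contra nik => /eqP <-.
- move=> i a b; have [p ->] := sigma_surj a; have [q ->] := sigma_surj b.
  rewrite /x /y -!rmorphM -rmorphD => /sigma_eq0 /(_ i).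
  rewrite restrD !restrM !restrU bxi byi => /syzygyX [|c [pE qE]].
    exact: vx_neq_vy.
  exists (sigma c); rewrite -!rmorphM -rmorphB -rmorphD.
  (* [syzygyX] applies only to the restrictions of [p] and [q]; idempotence of [restr] lets these
     stand for [p] and [q]. *)
  rewrite !(@sigma_mulX i) // !restrD restrN -[restr _ p]restr_id pE.
  rewrite -[restr _ q]restr_id qE !restrM restrN !restrU bxi byi.
  by rewrite subrr mulNr addNr.
- move=> i a b; have [p ->] := sigma_surj a; have [q ->] := sigma_surj b.
  rewrite /x /y -!rmorphM -rmorphD sigma_mulX // => pq0.
  apply/sigma_eq0 => j; have [-> //|ji] := eqVneq j i.
  rewrite restrD !restrM !restrU block_vx block_vy.
  by rewrite eq_sym val_eqE (negPf ji) !mulr0 addr0.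
- move=> a; split=> [[k [c [f [grf ->]]]]|].
    apply: (big_ind (span_pairs x y (enum 'I_m))) => [||i _].
    + exact: span_pairs0.
    + by move=> *; exact: span_pairsD.
    apply: span_pairsM; have [d d0 /gr_pos [//|q q0 ->]] := grf i.
    (* Restricting to no variable at all leaves the constant term, which is zero in positive
       degree. *)
    apply: (@span_pairs_restr pred0) => [j *|]; first exact: mem_enum.
    apply/restr_eq0P => u /forallP u0; suff -> : u = 0%MM by [].
    by apply/mnmP => j; rewrite mnm0E; exact/eqP/u0.
  have [I0 ID IM] := ideal_gen_closed [set a | exists2 d, (0 < d)%N & gr d a].
  elim: (enum 'I_m) a => [a ->|i s IH a [b [c [z [/IH zI ->]]]]].
    exact: I0.
  apply: (ID _ _ _ zI); apply: ID; apply: IM; apply: ideal_gen_mem;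
    by exists 1%N => //; exact: gr_sigmaX.
Qed.

End Blocks.

(** Evaluation at the origin is compatible with linear substitutions, so these preserve the constant
    coefficient. *)
Lemma meval_at0 (K : comNzRingType) N (q : {mpoly K[N]}) :
  q.@[fun=> 0] = q@_0%MM.
Proof.
rewrite mevalE [in RHS](mpolyE q) raddf_sum /=; apply: eq_bigr => u _.
rewrite mcoeffZ mcoeffX; congr (_ * _).
have [->|u0] := eqVneq u 0%MM; first by rewrite big1 // => i _; rewrite mnm0E.
have /existsP[i ui] : [exists i, u i != 0%N].
  by apply: contraNT u0 => /existsPn u0; apply/eqP/mnmP => i;
    rewrite mnm0E; apply/eqP/negPn.
by rewrite (bigD1 i) //= expr0n (negPf ui) mul0r.
Qed.

(** * Lines in general linear position *)

Section LinesInGeneralPosition.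
Variables (R : realType) (n m : nat) (m_gt0 : (0 < m)%N) (L : 'I_m -> line R n).
Hypotheses (genL : general_linear_position L) (le_2m : (2 * m <= n.+1)%N).
Local Notation C := (R[i]).
Local Notation S := {mpoly C[n.+1]}.
Local Notation blk := (@block n).

Lemma general_position_dim : \dim (\sum_i line_space (L i))%VS = (2 * m)%N.
Proof.
have := @genL (finset.setT : {set 'I_m}); rewrite cardsT card_ord => /(_ m_gt0).
rewrite (eq_bigl xpredT) => [|i]; last by rewrite inE.
rewrite (minn_idPl _); last by rewrite leq_subLR add1n.
(* The predecessor truncates at 0; this strict bound rules out a span of dimension 0. *)
have : (0 < 2 * m - 1)%N.
  by rewrite subn_gt0; case: m m_gt0 => // k _; rewrite mul2n.
case: (\dim _) => [|d] /= d0 dE; first by rewrite -dE in d0.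
by rewrite dE subn1 prednK // muln_gt0.
Qed.

Lemma defining_ideal_coordinates : exists2 M : 'M[C]_n.+1, M \in unitmx &
  forall p, defining_ideal L p <->
    (forall i : 'I_m, restr (blk i) (linear_subst M p) = 0).
Proof.
have [B [uB BL]] :=
  adapted_basis (fun i => line_dim (L i)) general_position_dim.
exists B^T; first by rewrite unitmx_tr.
have LB i p : line_ideal (L i) p <-> restr (blk i) (linear_subst B^T p) = 0.
  apply: line_idealP (BL i) => //.
  by exists (vx n i); have := block_vx le_2m i i; rewrite eqxx.
by move=> p; split=> [Jp i|Jp i _]; apply/LB => //; exact: Jp.
Qed.

(** In adapted coordinates these are the exponents of the monomials in the defining ideal. *)
Definition in_no_block (u : 'X_{1..n.+1}) :=
  forall i : 'I_m, ~~ supported (blk i) u.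

Lemma in_no_block_le u w : (u <= w)%MM -> in_no_block u -> in_no_block w.
Proof.
move=> uw Qu i; apply: contra (Qu i).
by rewrite -(submK uw) supported_add => /andP[].
Qed.

(** A variable [k] dividing [u] either lies in none of the blocks, and then is itself in the ideal,
    or lies in a block [i]. In the latter case [u] also involves a variable [l] outside block [i],
    and the product of the two is in the ideal. Minimality makes [u] equal to this divisor of degree
    1 or 2. *)
Lemma mdeg_minimal_in_no_block u : in_no_block u ->
  (forall w, (w <= u)%MM -> in_no_block w -> w = u) -> (mdeg u <= 2)%N.
Proof.
move=> Qu umin.
(* Any block serves here; it only provides some variable dividing [u]. *)
have [k _ ku] := not_supported (Qu (Ordinal m_gt0)).
case: (boolP (k < 2 * m)%N) => [/(block_cases le_2m) [i ik _]|km].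
  have [l nil lu] := not_supported (Qu i).
  have kl : k != l by apply: contraNneq nil => <-.
  rewrite -(umin (U_(k) + U_(l))%MM) ?mdegD ?mdeg1 //.
    apply/mnm_lepP => j; rewrite mnmDE !mnm1E.
    have [<-|kj] := eqVneq k j.
      by rewrite eq_sym (negPf kl) addn0 lt0n -lep1mP.
    by case: eqVneq => // <-; rewrite lt0n -lep1mP.
  move=> j; rewrite supported_add !supported_mnm1.
  apply: contra nil => /andP[jk jl]; rewrite /block -(eqP ik) (eqP jk).
  exact: jl.
rewrite -(umin U_(k)%MM) ?mdeg1 // => i; rewrite supported_mnm1 /block.
apply: contra km => /eqP ki.
by rewrite mul2n -ltn_half_double ki.
Qed.

Lemma restr_blocks_eq0 (q : S) : (forall i : 'I_m, restr (blk i) q = 0) <->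
  (forall u, q@_u != 0 -> in_no_block u).
Proof.
split=> [q0 u qu i|qQ i].
  by apply: contraNN qu => iu; apply/eqP; move: u iu; apply/restr_eq0P.
apply/restr_eq0P => u iu; apply/eqP; apply: contraTT iu => /qQ; exact.
Qed.

Lemma coordinate_ring_koszul : koszul (coordinate_ring_gr m_gt0 L).
Proof.
have [M uM ME] := defining_ideal_coordinates.
pose A := coordinate_ring m_gt0 L.
pose pi : {rmorphism S -> A} := \pi_{ideal_quot (defining_idealr m_gt0 L)}%qT.
(* This is [linear_subst (invmx M)], spelled out so that its ring morphism structure is found. It
   carries adapted coordinates back to the original ones before passing to the quotient. *)
pose psi : {rmorphism S -> S} :=
  comp_mpoly [tuple \sum_j invmx M i j *: 'X_j | i < n.+1].
have pi_surj a : exists p, a = pi p.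
  by exists (repr a); apply/esym; exact: reprK.
have pi_eq0 p : pi p = 0 <-> defining_ideal L p.
  have -> : pi p = 0 <-> \pi_A%qT p == \pi_A%qT 0.
    by rewrite -[0](raddf0 pi); split=> /eqP.
  by rewrite -Quotient.idealrBE subr0; split=> /asboolP.
apply: (@blocks_koszul _ n m le_2m A _ (pi \o psi)).
- move=> a; have [p ->] := pi_surj a.
  by exists (linear_subst M p); rewrite /= -[p in LHS](linear_substK uM).
- move=> q; rewrite /= pi_eq0 ME.
  by rewrite -[X in linear_subst M X]/(linear_subst (invmx M) q) linear_substVK.
- by exists 0; [exact: rpred0|exact: raddf0].
- by move=> _ [p ph <-]; exists (- p); [exact: rpredNr|exact: raddfN].
- move=> k; exists (linear_subst (invmx M) 'X_k) => //.
  exact: linear_substU_homog.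
- move=> d _ d0 [p ph <-]; exists (linear_subst M p); last first.
    by rewrite /= -[p in LHS](linear_substK uM).
  have p0 : p@_0%MM = 0.
    by apply: (dhomog_nemf_coeff ph); rewrite /= mdeg0 eq_sym -lt0n.
  rewrite -[RHS]p0 -!meval_at0 linear_subst_meval; apply: meval_eq => i.
  by apply: big1 => j _; rewrite mulr0.
Qed.

End LinesInGeneralPosition.

Theorem proposition4p1 (R : realType) (n m : nat) (n_ge3 : (3 <= n)%N)
    (m_gt0 : (0 < m)%N) (L : 'I_m -> line R n)
    (genL : general_linear_position L) (le_2m : (2 * m <= n + 1)%N) :
  (exists M : 'M[R[i]]_n.+1, M \in unitmx /\
     exists2 G : set {mpoly R[i][n.+1]},
       (forall f, G f ->
          exists u : 'X_{1..n.+1}, (mdeg u <= 2)%N /\ f = 'X_[u]) &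
       minimally_generates G (linear_subst M @` defining_ideal L)) /\
  koszul (coordinate_ring_gr m_gt0 L).
Proof.
rewrite addn1 in le_2m; split; last exact: coordinate_ring_koszul.
have [M uM ME] := defining_ideal_coordinates m_gt0 genL le_2m.
exists M; split=> //; exists (@minimal_monomials _ _ (@in_no_block n m)).
  move=> _ [u [-> Qu umin]]; exists u; split=> //.
  exact: (mdeg_minimal_in_no_block m_gt0 le_2m).
(* The transformed ideal is a monomial ideal, so its minimal monomials generate it irredundantly. *)
have -> : linear_subst M @` defining_ideal L =
    [set q | forall u, q@_u != 0 -> @in_no_block n m u].
  apply/seteqP; split=> [_ [p /ME /restr_blocks_eq0 Jp <-] //|q Hq].
  exists (linear_subst (invmx M) q); last exact: linear_substVK.
  by apply/ME; rewrite linear_substVK //; exact/restr_blocks_eq0.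
exact (@minimally_generates_monomials R[i] n.+1 _ (@in_no_block_le n m)).
Qed.
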